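(* Let $n\geq 4$ and let $G$ be a simple graph on $n$ vertices such that both $G$ and its complement $\overline{G}$ are connected. Then $rc(G)+rc(\overline{G})\leq n+2$. Moreover, this bound is best possible: for every $n\geq 4$ there exists a graph $G$ on $n$ vertices with $G$ and $\overline{G}$ both connected and $rc(G)+rc(\overline{G})=n+2$.
   Context: All graphs are simple, finite and undirected. For a connected graph $G$, an edge coloring $c:E(G)\to\{1,\dots,k\}$ (adjacent edges may receive the same color) makes $G$ rainbow connected if for every two vertices $u,v$ there is a $u$–$v$ path whose edges have pairwise distinct colors. The rainbow connection number $rc(G)$ is the minimum $k$ for which such a coloring exists. $\overline{G}$ denotes the complement of $G$. *)

(* Defs.v *)
From mathcomp Require Import all_boot.
From mathcomp Require Import boolp.

Set Implicit Arguments.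
Unset Strict Implicit.
Unset Printing Implicit Defensive.

Record sgraph := SGraph {
  vertex :> finType;
  adj : rel vertex;
  adj_sym : symmetric adj;
  adj_irrefl : irreflexive adj }.

Section Complement.
Variable G : sgraph.

Definition compl_adj : rel G := [rel x y | (x != y) && ~~ adj x y].

Lemma compl_adj_sym : symmetric compl_adj.
Proof. by move=> x y; rewrite /compl_adj /= eq_sym adj_sym. Qed.

Lemma compl_adj_irrefl : irreflexive compl_adj.
Proof. by move=> x; rewrite /compl_adj /= eqxx. Qed.

Definition compl : sgraph := SGraph compl_adj_sym compl_adj_irrefl.
End Complement.

Definition edges (G : sgraph) : {set {set G}} :=
  [set [set x; y] | x in G, y in G & adj x y].

Definition connected (G : sgraph) : Prop :=
  forall x y : G, connect (@adj G) x y.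

(* Colorings are total on [{set G}]; only their values on edges matter. *)
Definition edge_coloring (G : sgraph) (k : nat) (c : {set G} -> nat) : Prop :=
  forall A : {set G}, A \in edges G -> 1 <= c A <= k.

Definition path_edges (G : sgraph) (u : G) (p : seq G) : seq {set G} :=
  pairmap (fun x y : G => [set x; y]) u p.

(* The path has vertex sequence [u :: p]. *)
Definition rainbow_path (G : sgraph) (c : {set G} -> nat)
    (u v : G) (p : seq G) : Prop :=
  [/\ path (@adj G) u p, last u p = v, uniq (u :: p)
    & uniq [seq c A | A <- path_edges u p]].

Definition rainbow_connected (G : sgraph) (c : {set G} -> nat) : Prop :=
  forall u v : G, exists p : seq G, rainbow_path c u v p.

Definition rainbow_colorable (G : sgraph) (k : nat) : Prop :=
  exists2 c : {set G} -> nat, edge_coloring k c & rainbow_connected c.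

Lemma path_edges_sub (G : sgraph) (u : G) (p : seq G) (A : {set G}) (x : G) :
  A \in path_edges u p -> x \in A -> x \in u :: p.
Proof.
elim: p u => [|y p IHp] u //=; rewrite inE => /orP[/eqP->|Ap xA].
  by rewrite !inE => /orP[]->; rewrite ?orbT.
by rewrite inE (IHp y Ap xA) orbT.
Qed.

Lemma path_edges_uniq (G : sgraph) (u : G) (p : seq G) :
  uniq (u :: p) -> uniq (path_edges u p).
Proof.
elim: p u => [|y p IHp] u //= /andP[uNp Up]; apply/andP; split; last exact: IHp.
by apply: contra uNp => /path_edges_sub; apply; rewrite !inE eqxx.
Qed.

Lemma connected_colorable (G : sgraph) :
  connected G -> exists k, `[< rainbow_colorable G k >].
Proof.
move=> conG; exists #|{set G}|; apply/asboolP.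
exists (fun A : {set G} => (enum_rank A).+1) => [A _|u v].
  by rewrite /= ltn_ord.
have /connectP[p0 up0 ->] := conG u v.
have [p up Up _] := shortenP up0; exists p; split=> //.
rewrite map_inj_uniq; first exact: path_edges_uniq.
by move=> A B [] /val_inj/enum_rank_inj.
Qed.

Definition rc (G : sgraph) (conG : connected G) : nat :=
  ex_minn (connected_colorable conG).

Lemma rcP (G : sgraph) (conG : connected G) :
  rainbow_colorable G (rc conG) /\
  forall k, rainbow_colorable G k -> rc conG <= k.
Proof.
rewrite /rc; case: ex_minnP => m /asboolP Gm min_m; split=> // k Gk.
by apply: min_m; apply/asboolP.
Qed.

(* Main.v *)
Require Import Defs.
From mathcomp Require Import all_boot.
From mathcomp Require Import boolp zify.

Set Implicit Arguments.
Unset Strict Implicit.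
Unset Printing Implicit Defensive.

(* The upper bound goes by induction on the number of vertices, for induced
   subgraphs [S] of a graph [e] and its complement [f]. On at least five
   vertices some [v] is a cut vertex of neither graph. If [v] is a leaf of one
   graph, putting it back costs one color there and none in the other graph,
   where [v] is adjacent to all vertices but one. Otherwise (from six vertices
   on) a second such vertex [u] of [S :\ v] is removed; say [u] and [v] are
   adjacent in [f]. If they have a common neighbor in [e], putting both back
   costs one color in each graph. If not, [uv] is a dominating edge of [f], so
   it costs nothing in [f] as soon as three colors are available there, and at
   most two in [e]; and if [f] needs at most three colors then a spanning tree
   of [e] suffices. The bound is attained by a star with one subdivided edge:
   it is a tree any two of whose edges lie on a common path, and its complement
   has diameter three. *)

(** * Connectivity of induced subgraphs *)

Section Connectivity.
Variable T : finType.
Implicit Types (e f : rel T) (S A B R X : {set T}) (u v w x y z : T).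

(** Connectivity of the subgraph induced on [S], phrased by closed sets instead of paths: a set that
    meets [S] and is stable under [e]-steps inside [S] swallows [S]. Deleting or adding a vertex
    then requires no surgery on paths. *)
Definition conn e S : Prop :=
  forall X : {set T}, (exists2 x, x \in S & x \in X) ->
    (forall x y, x \in S -> y \in S -> x \in X -> e x y -> y \in X) ->
    {subset S <= X}.

(** By symmetry the complement of a closed set is closed, so if [X] misses [r], the hypothesis
    applied to [~: X] contradicts that [X] meets [S]. *)
Lemma conn_root e S r : symmetric e -> r \in S ->
  (forall X, r \in X ->
    (forall x y, x \in S -> y \in S -> x \in X -> e x y -> y \in X) ->
    {subset S <= X}) -> conn e S.
Proof.
move=> e_sym Sr rS X [x Sx Xx] clX.
have [Xr|XNr] := boolP (r \in X); first exact: rS.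
have /(_ x Sx) : {subset S <= ~: X}.
  apply: rS => [|y z Sy Sz]; first by rewrite inE.
  by rewrite !inE => XNy yz; apply: contra XNy => /(clX z y); rewrite e_sym; apply.
by rewrite inE Xx.
Qed.

Lemma conn_cut e S X x y : conn e S -> x \in S -> x \in X -> y \in S ->
  y \notin X -> exists a b, [/\ a \in S, b \in S, a \in X, b \notin X & e a b].
Proof.
move=> conS Sx Xx Sy XNy; apply: contrapT => noab; move/negP: XNy; apply.
apply: (conS X) => //; first by exists x.
move=> a b Sa Sb Xa ab; apply/negPn/negP => XNb.
by apply: noab; exists a, b.
Qed.

Lemma not_conn e S : ~ conn e S -> exists x y X,
  [/\ x \in S, x \in X, y \in S, y \notin X &
    forall a b, a \in S -> b \in S -> a \in X -> b \notin X -> ~~ e a b].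
Proof.
move=> nconS; apply: contrapT => H; apply: nconS => X [x Sx Xx] clX y Sy.
apply/negPn/negP => XNy; apply: H; exists x, y, X; split=> // a b Sa Sb Xa.
by apply: contra => /(clX a b Sa Sb Xa).
Qed.

Lemma conn_nbr e S x : conn e S -> x \in S -> 1 < #|S| ->
  exists2 y, y \in S :\ x & e x y.
Proof.
move=> conS Sx S_gt1.
have /card_gt0P[z] : 0 < #|S :\ x| by move: S_gt1; rewrite (cardsD1 x) Sx.
rewrite !inE => /andP[zNx Sz].
have [||a [b [_ Sb]]] := conn_cut (X := [set x]) conS Sx _ Sz; rewrite ?inE //.
by move=> /eqP -> bNx xb; exists b; rewrite // !inE bNx.
Qed.

Lemma conn_add e S x y : symmetric e -> conn e S -> x \in S -> e x y ->
  conn e (y |: S).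
Proof.
move=> e_sym conS Sx xy; apply: (conn_root (r := x)) => //.
  by rewrite !inE Sx orbT.
move=> X Xx clX; have sSX : {subset S <= X}.
  apply: conS => [|a b Sa Sb]; first by exists x.
  by apply: clX; rewrite !inE ?Sa ?Sb orbT.
move=> z /setU1P[->|/sSX//].
by apply: (clX x); rewrite // !inE ?eqxx ?Sx ?orbT.
Qed.

Lemma ltn_cardsD1 m x S : m.+1 < #|S| -> m < #|S :\ x|.
Proof. by rewrite (cardsD1 x S); case: (x \in S) => //= /ltnW. Qed.

Lemma conn1 e x : conn e [set x].
Proof. by move=> X [_ /set1P-> Xx] _ _ /set1P->. Qed.

Lemma conn_grow e R S x : symmetric e -> conn e R -> conn e S ->
  R \subset S -> x \in R -> R != S ->
  exists y, [/\ y \in S, y \notin R, conn e (y |: R) & exists2 a, a \in R & e a y].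
Proof.
move=> e_sym conR conS sRS Rx RneS.
have /subsetPn[z Sz RNz] : ~~ (S \subset R).
  by apply: contra RneS => sSR; rewrite eqEsubset sRS.
have [a [b [_ Sb Ra RNb ab]]] := conn_cut conS (subsetP sRS x Rx) Rx Sz RNz.
by exists b; split=> //; [apply: conn_add ab | exists a].
Qed.

(** Let [R] grow inside [S] by one attached vertex at a time, staying connected; the last vertex to
    be added is not a cut vertex of [S]. *)
Lemma noncut_outside e R S x : symmetric e -> conn e R -> conn e S ->
  R \subset S -> x \in R -> R != S ->
  exists u, [/\ u \in S, u \notin R & conn e (S :\ u)].
Proof.
move=> e_sym + conS.
have [m] := ubnP #|S :\: R|; elim: m R => // m IHm R Rm conR sRS Rx RneS.
have [y [Sy RNy conyR _]] := conn_grow e_sym conR conS sRS Rx RneS.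
have [yRS|yRneS] := eqVneq (y |: R) S.
  exists y; split=> //; suff -> : S :\ y = R by [].
  by rewrite -yRS setU1K.
have [|||||u [Su yRNu conu]] := IHm (y |: R); rewrite ?inE ?Rx ?orbT //.
- have : S :\: (y |: R) \proper S :\: R.
    apply/properP; split; first by rewrite setDS ?subsetUr.
    by exists y; rewrite !inE ?Sy ?RNy ?eqxx.
  by move=> /proper_card; move: Rm; lia.
- by rewrite subUset sub1set Sy.
exists u; split=> //; apply: contra yRNu; rewrite inE => ->; exact: orbT.
Qed.

(** * Vertices that cut neither a graph nor its complement *)

Definition co e f := forall x y, x != y -> f x y = ~~ e x y.

Lemma coC e f : co e f -> co f e.
Proof. by move=> ef x y /ef->; rewrite negbK. Qed.

(** If a closed [X] containing [c] missed a vertex of [c |: A], some edge would leave [X :|: B]. It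
    cannot start in [B], whose edges lead only to [B] and [c], nor in [c |: A], where [X] is
    closed. *)
Lemma conn_side e S A B c : symmetric e -> conn e S ->
  (forall x, x \in S = [|| x == c, x \in A | x \in B]) ->
  (forall x y, x \in A -> y \in B -> ~~ e x y) ->
  [disjoint A & B] -> c \notin B -> conn e (c |: A).
Proof.
move=> e_sym conS SE AB dAB BNc.
apply: (conn_root (r := c)); rewrite ?setU11 // => X Xc clX x cAx.
apply: contraT => XNx.
have Sx : x \in S by rewrite SE orbA -in_setU1 cAx.
have XBNx : x \notin X :|: B.
  rewrite inE negb_or XNx; move: cAx; rewrite inE => /orP[/set1P->//|Ax].
  by rewrite (disjointFr dAB).
have [||p [q [Sp Sq XBp]]] := conn_cut (x := c) conS _ _ Sx XBNx.
- by rewrite SE eqxx.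
- by rewrite inE Xc.
rewrite inE negb_or => /andP[XNq BNq] pq.
have cAq : q \in c |: A by move: Sq; rewrite SE !inE (negPf BNq) orbF.
move: XBp; rewrite inE => /orP[Xp|Bp].
  have [Bp|BNp] := boolP (p \in B); last first.
    by rewrite (clX p q) // in XNq; move: Sp; rewrite SE !inE (negPf BNp) orbF.
  move: cAq; rewrite !inE => /orP[/eqP qc|Aq]; first by rewrite qc Xc in XNq.
  by have := AB q p Aq Bp; rewrite e_sym pq.
move: cAq; rewrite !inE => /orP[/eqP qc|Aq]; first by rewrite qc Xc in XNq.
by have := AB q p Aq Bp; rewrite e_sym pq.
Qed.

(* Across a cut of [S :\ c] in [e], the relation [f] is complete bipartite. *)
Lemma cut_noncut e f S c : symmetric e -> symmetric f -> co e f ->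
  conn e S -> conn f S -> 4 < #|S| -> c \in S -> ~ conn e (S :\ c) ->
  exists v, [/\ v \in S, conn e (S :\ v) & conn f (S :\ v)].
Proof.
move=> e_sym f_sym ef conS fconS S_gt4 Sc /not_conn[a [b [X]]].
move=> [Sa Xa Sb XNb noX].
have [d Sd cd] : exists2 d, d \in S :\ c & f c d by apply: conn_nbr => //; lia.
(* The two sides of the cut are named so that the [f]-neighbor [d] of [c] lies in [B]; removing a
   vertex of [A] then leaves [c] attached in [f]. *)
have [A [B [SAB [a0 Aa0] Bd dAB AB]]] : exists A B, [/\ S :\ c = A :|: B,
    exists a0, a0 \in A, d \in B, [disjoint A & B]
    & forall x y, x \in A -> y \in B -> ~~ e x y].
  have dis : [disjoint (S :\ c) :&: X & (S :\ c) :\: X].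
    rewrite -setI_eq0; apply/eqP/setP => x; rewrite !inE.
    by case: (x \in X); rewrite ?andbF.
  have [Xd|XNd] := boolP (d \in X).
  - exists ((S :\ c) :\: X), ((S :\ c) :&: X); split.
    + by rewrite setUC setID.
    + by exists b; rewrite inE XNb.
    + by rewrite inE Xd Sd.
    + by rewrite disjoint_sym.
    + move=> x y /setDP[Sx XNx] /setIP[Sy Xy].
      by rewrite e_sym noX.
  - exists ((S :\ c) :&: X), ((S :\ c) :\: X); split=> //.
    + by rewrite setID.
    + by exists a; rewrite inE Sa Xa.
    + by rewrite inE Sd XNd.
    + move=> x y /setIP[Sx Xx] /setDP[Sy XNy].
      by rewrite noX.
clear a b X Sa Xa Sb XNb noX.
have SE x : x \in S = [|| x == c, x \in A | x \in B].
  by rewrite -[_ || (_ \in B)]in_setU -SAB !inE; case: eqP => //= ->.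
have ANc : c \notin A.
  by apply/negP => Ac; have := setD11 c S; rewrite SAB inE Ac.
have BNc : c \notin B.
  by apply/negP => Bc; have := setD11 c S; rewrite SAB inE Bc orbT.
have ANB x y : x \in A -> y \in B -> x != y.
  by move=> Ax By; apply: contraTneq Ax => ->; rewrite (disjointFl dAB).
have fAB x y : x \in A -> y \in B -> f x y.
  by move=> Ax By; rewrite ef ?AB ?ANB.
have Bcd x : x \in B -> x != c by move=> Bx; apply: contraNneq BNc => <-.
have Acd x : x \in A -> x != c by move=> Bx; apply: contraNneq ANc => <-.
have conA : conn e (c |: A) by apply: (conn_side e_sym conS SE).
have conB : conn e (c |: B).
  apply: (conn_side (B := A) e_sym conS) => // [x|x y Bx Ay|].
  - by rewrite SE [(x \in A) || _]orbC.
  - by rewrite e_sym AB.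
  - by rewrite disjoint_sym.
have sAS : c |: A \subset S by apply/subsetP => x; rewrite !inE SE orbA => ->.
have sBS : c |: B \subset S.
  by apply/subsetP => x; rewrite !inE SE orbCA => ->; rewrite orbT.
(* As [f] is complete bipartite between [A] and [B], deleting [u] keeps [f] connected as long as
   both sides keep a vertex and [c] keeps an [f]-neighbor. *)
have fconD u d' a1 b1 : u != c -> d' \in A :|: B -> d' != u -> f c d' ->
    a1 \in A -> a1 != u -> b1 \in B -> b1 != u -> conn f (S :\ u).
  move=> uNc ABd' d'u cd' Aa1 a1u Bb1 b1u.
  have Sc' : c \in S :\ u by rewrite !inE eq_sym uNc.
  have SA x : x \in A -> x != u -> x \in S :\ u by rewrite !inE SE => -> ->; rewrite orbT.
  have SB x : x \in B -> x != u -> x \in S :\ u by rewrite !inE SE => -> ->; rewrite !orbT.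
  apply: (conn_root (r := c)) => // X Xc clX.
  have Xa1b1 : a1 \in X /\ b1 \in X.
    case/setUP: ABd' => ABd'.
      have Xd' : d' \in X by apply: (clX c) => //; exact: SA.
      have Xb1 : b1 \in X by apply: (clX d'); auto.
      by split=> //; apply: (clX b1); auto; rewrite f_sym; auto.
    have Xd' : d' \in X by apply: (clX c) => //; exact: SB.
    have Xa1 : a1 \in X by apply: (clX d'); auto; rewrite f_sym; auto.
    by split=> //; apply: (clX a1); auto.
  case: Xa1b1 => Xa1 Xb1 x /setD1P[xu]; rewrite SE => /or3P[/eqP->//|Ax|Bx].
    by apply: (clX b1); auto; rewrite f_sym; auto.
  by apply: (clX a1); auto.
(* If [A] has a second vertex, growing [c |: B] yields a vertex [u] of [A] that does not cut [e];
   [A] keeps a vertex and [d] stays in [B]. *)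
have [A1|/eqP A_eq] := altP (A =P [set a0]); last first.
  have [] := noncut_outside (x := c) e_sym conB conS sBS (setU11 _ _).
    apply: contraTneq (Acd _ Aa0) => cBS.
    have : a0 \in c |: B by rewrite cBS SE Aa0 orbT.
    by rewrite !inE => /orP[->//|Ba0]; have := ANB _ _ Aa0 Ba0; rewrite eqxx.
  move=> u [Su]; rewrite !inE negb_or => /andP[uNc BNu] conu; exists u; split=> //.
  have Au : u \in A by move: Su; rewrite SE (negPf uNc) (negPf BNu) orbF.
  have [a1 Aa1 a1u] : exists2 a1, a1 \in A & a1 != u.
    apply: contrapT => no; apply: A_eq.
    have Au' x : x \in A -> x = u.
      by move=> Ax; apply/eqP/negPn/negP => xu; apply: no; exists x.
    by apply/setP => x; rewrite inE; apply/idP/eqP => [/Au'->|->//]; rewrite (Au' a0).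
  apply: (fconD u d a1 d) => //; rewrite ?inE ?Bd ?orbT //;
    by apply: contraNneq BNu => <-.
have a0c : e a0 c.
  have [||y] := conn_nbr (x := a0) conS; rewrite ?SE ?Aa0 ?orbT //; first by lia.
  rewrite !inE SE A1 inE => /andP[/negPf->] /orP[/eqP->//|/= By].
  by rewrite (negPf (AB _ _ Aa0 By)).
(* Now [A] is [a0] alone and [u] must come from [B]. With a second [f]-neighbor [d'], the vertex [c]
   keeps [d] or [d'] whichever [u] is removed. *)
have [[d' [Sd' d'c d'd cd']]|no] :=
    EM (exists d', [/\ d' \in S, d' != c, d' != d & f c d']).
  have [] := noncut_outside (x := c) e_sym conA conS sAS (setU11 _ _).
    apply: contraTneq Bd => cAS; move: (Sd); rewrite !inE -cAS !inE.
    by case: eqP => //= _ Ad; rewrite (disjointFr dAB).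
  move=> u [Su]; rewrite !inE negb_or => /andP[uNc ANu] conu; exists u; split=> //.
  have Bu : u \in B by move: Su; rewrite SE (negPf uNc) (negPf ANu).
  have [b1 Bb1 b1u] : exists2 b1, b1 \in B & b1 != u.
    have : 0 < #|S :\ c :\ a0 :\ u|.
      by do 3!apply: ltn_cardsD1; apply: ltnW.
    case/card_gt0P => x; rewrite !inE SE A1 inE.
    by case/and4P=> xu /negPf-> /negPf-> /=; exists x.
  have a0u : a0 != u by apply: contraNneq ANu => <-.
  have ABd' : d' \in A :|: B by rewrite -SAB !inE d'c.
  have [du|du] := eqVneq d u.
    by apply: (fconD u d' a0 b1); rewrite // -du.
  by apply: (fconD u d a0 b1); rewrite // inE Bd orbT.
(* Otherwise [d] is the only [f]-neighbor of [c] and must be kept. The set of [d], an [e]-neighbor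
   [y] of [d], [a0] and [c] is connected in [e] and has at most four vertices, so [u] can be found
   outside it. *)
have ecx x : x \in S -> x != c -> x != d -> e c x.
  move=> Sx xc xd; apply: contraT => nex; case: no; exists x; split=> //.
  by rewrite ef // eq_sym.
have nedc : ~~ e d c by rewrite e_sym -[e c d]negbK -ef ?cd // eq_sym Bcd.
have [||y Sy dy] := conn_nbr (x := d) conS; rewrite ?SE ?Bd ?orbT //; first by lia.
move: Sy; rewrite !inE => /andP[yd Sy].
have yc : y != c by apply: contraTneq dy => ->.
have conR : conn e (d |: (y |: (a0 |: [set c]))).
  apply: (conn_add (x := y)); rewrite ?setU11 // 1?e_sym //.
  apply: (conn_add (x := c)); rewrite ?inE ?eqxx ?orbT //; last exact: ecx.
  by apply: (conn_add (x := c)); rewrite ?inE ?eqxx // 1?e_sym //; exact: conn1.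
have [|||u [Su RNu conu]] := noncut_outside (x := c) e_sym conR conS.
- apply/subsetP => x; rewrite !inE => /or4P[] /eqP->//; last by rewrite SE Aa0 orbT.
  by rewrite SE Bd !orbT.
- by rewrite !inE eqxx !orbT.
- by apply: contraTneq S_gt4 => <-; rewrite !cardsU1 cards1; do 3!case: (_ \notin _).
move: RNu; rewrite !inE !negb_or => /and4P[ud uy ua uc].
exists u; split=> //; apply: (fconD u d a0 d); rewrite // 1?eq_sym //.
by rewrite inE Bd orbT.
Qed.

Lemma common_noncut e f S : symmetric e -> symmetric f -> co e f ->
  conn e S -> conn f S -> 4 < #|S| ->
  exists v, [/\ v \in S, conn e (S :\ v) & conn f (S :\ v)].
Proof.
move=> e_sym f_sym ef eS fS S_gt4.
have /card_gt0P[v Sv] : 0 < #|S| by lia.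
have [eSv|nev] := EM (conn e (S :\ v)); last exact: (cut_noncut e_sym f_sym ef) nev.
have [fSv|nfv] := EM (conn f (S :\ v)); first by exists v.
by have [u []] := cut_noncut f_sym e_sym (coC ef) fS eS S_gt4 Sv nfv; exists u.
Qed.

End Connectivity.

(** * Extending rainbow colorings *)

Section RainbowSets.
Variable T : finType.
Implicit Types (e f : rel T) (S N R : {set T}) (u v w x y z : T).
Implicit Types (c : T -> T -> nat) (s : seq nat) (k l : nat).

(** A walk inside [S] is recorded by its sequence of colors only. Vertices may repeat; a rainbow
    walk is shortened to a rainbow path in [walk_path]. *)
Inductive walk e S c : T -> T -> seq nat -> Prop :=
| walk_nil x : x \in S -> walk e S c x x [::]
| walk_cons x y z s : x \in S -> e x y -> walk e S c y z s ->
    walk e S c x z (c x y :: s).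

Lemma walk_in e S c x y s : walk e S c x y s -> x \in S /\ y \in S.
Proof. by elim=> // u v w t Su _ _ []. Qed.

Lemma walk_edge e S c x y : x \in S -> y \in S -> e x y -> walk e S c x y [:: c x y].
Proof. by move=> Sx Sy xy; apply: walk_cons => //; apply: walk_nil. Qed.

Lemma walk_rcons e S c x y z s : z \in S -> e y z -> walk e S c x y s ->
  walk e S c x z (rcons s (c y z)).
Proof.
move=> Sz yz w; elim: w yz => {x y s} [x Sx|x y w s Sx xy _ IH] yz.
  exact: walk_edge.
by apply: walk_cons => //; apply: IH.
Qed.

Lemma walk_rev e S c x y s : symmetric e -> (forall x y, c x y = c y x) ->
  walk e S c x y s -> walk e S c y x (rev s).
Proof.
move=> e_sym c_sym; elim=> {x y s} [x Sx|x y z s Sx xy _ IH]; first exact: walk_nil.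
by rewrite rev_cons c_sym; apply: walk_rcons; rewrite // e_sym.
Qed.

Lemma walk_sub e S S' c c' x y s : S \subset S' ->
  (forall a b, a \in S -> b \in S -> c a b = c' a b) ->
  walk e S c x y s -> walk e S' c' x y s.
Proof.
move=> sSS' cc'; elim=> {x y s} [x Sx|x y z s Sx xy w IH].
  by apply: walk_nil; apply: (subsetP sSS').
rewrite cc' //; first by apply: walk_cons => //; apply: (subsetP sSS').
by case: (walk_in w).
Qed.

Lemma walk_lt e S c k x y s : (forall a b, c a b < k) -> walk e S c x y s ->
  all (fun i => i < k) s.
Proof. by move=> ck; elim=> //= {x y s} x y z s _ _ _ ->; rewrite ck. Qed.

Definition rainbow e S c x y := exists2 s, walk e S c x y s & uniq s.

Lemma rainbow_sym e S c x y : symmetric e -> (forall x y, c x y = c y x) ->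
  rainbow e S c x y -> rainbow e S c y x.
Proof.
by move=> e_sym c_sym [s w Us]; exists (rev s); [apply: walk_rev|rewrite rev_uniq].
Qed.

Lemma rainbow_refl e S c x : x \in S -> rainbow e S c x x.
Proof. by exists [::] => //; apply: walk_nil. Qed.

Lemma rainbow_edge e S c x y : x \in S -> y \in S -> e x y -> rainbow e S c x y.
Proof. by exists [:: c x y] => //; apply: walk_edge. Qed.

Lemma rainbow_via e S c x z y : x \in S -> z \in S -> y \in S ->
  e x z -> e z y -> c x z != c z y -> rainbow e S c x y.
Proof.
move=> Sx Sz Sy xz zy nc; exists [:: c x z; c z y]; last by rewrite /= inE nc.
by apply: walk_cons => //; apply: walk_edge.
Qed.

(* Requiring [c x y < k] for all pairs, not only for edges, loses nothing. *)
Definition rainbow_coloring e S k c :=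
  [/\ forall x y, c x y = c y x, forall x y, c x y < k
    & forall x y, x \in S -> y \in S -> rainbow e S c x y].

Definition rcol e S k := exists c, rainbow_coloring e S k c.

Lemma rcol_mono e S k l : k <= l -> rcol e S k -> rcol e S l.
Proof.
by move=> kl [c [cs ck rb]]; exists c; split=> // x y; apply: leq_trans (ck x y) kl.
Qed.

Lemma rcol_clique e S : {in S &, forall x y, x != y -> e x y} -> rcol e S 1.
Proof.
move=> eS; exists (fun _ _ => 0); split=> // x y Sx Sy.
have [->|xy] := eqVneq x y; first exact: rainbow_refl.
by apply: rainbow_edge => //; apply: eS.
Qed.

Definition ext_color (N : {set T}) c (d : T -> T -> nat) x y :=
  if (x \in N) || (y \in N) then d x y else c x y.

Lemma ext_colorl N c d x y : x \in N -> ext_color N c d x y = d x y.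
Proof. by rewrite /ext_color => ->. Qed.

Lemma ext_colorr N c d x y : y \in N -> ext_color N c d x y = d x y.
Proof. by rewrite /ext_color => ->; rewrite orbT. Qed.

Lemma walk_ext e S N c d x y s : [disjoint S & N] ->
  walk e S c x y s -> walk e (N :|: S) (ext_color N c d) x y s.
Proof.
move=> dSN; apply: walk_sub => [|a b Sa Sb]; first exact: subsetUr.
by rewrite /ext_color !(disjointFr dSN).
Qed.

(** The color of [v w] is at least [k], hence absent from the old rainbow walk from [w] to [y], to
    which this edge is prepended. *)
Lemma rainbow_fresh e S N k c d v w y : rainbow_coloring e S k c ->
  [disjoint S & N] -> v \in N -> w \in S -> e v w -> k <= d v w -> y \in S ->
  rainbow e (N :|: S) (ext_color N c d) v y.
Proof.
move=> [_ ck rb] dSN Nv Sw vw kd Sy.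
have [s p Us] := rb w y Sw Sy; exists (d v w :: s).
  rewrite -(@ext_colorl N c) //; apply: walk_cons => //; first by rewrite inE Nv.
  exact: walk_ext.
rewrite /= Us andbT; apply/negP => sd.
by have /allP/(_ _ sd) := walk_lt ck p; rewrite ltnNge kd.
Qed.

(** Pairs inside [S] keep their colors and thus their rainbow walks, so only pairs of vertices that
    meet [N] remain to be checked. *)
Lemma ext_coloring e S N k l c d : symmetric e -> rainbow_coloring e S k c ->
    [disjoint S & N] -> k <= l ->
    (forall x y, d x y = d y x) -> (forall x y, d x y < l) ->
    (forall x y, x \in N -> y \in S -> rainbow e (N :|: S) (ext_color N c d) x y) ->
    (forall x y, x \in N -> y \in N -> rainbow e (N :|: S) (ext_color N c d) x y) ->
  rcol e (N :|: S) l.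
Proof.
move=> e_sym [cs ck rb] dSN kl ds dl newS newN.
have c's x y : ext_color N c d x y = ext_color N c d y x.
  by rewrite /ext_color orbC cs ds.
exists (ext_color N c d); split=> // [x y|x y].
  by rewrite /ext_color; case: ifP => // _; apply: leq_trans (ck x y) kl.
move=> /setUP[Nx|Sx] /setUP[Ny|Sy]; first exact: newN.
- exact: newS.
- by apply: rainbow_sym => //; apply: newS.
- by have [s w Us] := rb x y Sx Sy; exists s => //; apply: walk_ext.
Qed.

Lemma rcol_add e S v w k : symmetric e -> v \notin S -> w \in S -> e v w ->
  rcol e S k -> rcol e (v |: S) k.+1.
Proof.
move=> e_sym SNv Sw vw [c cS].
have dS : [disjoint S & [set v]] by rewrite disjoint_sym disjoints1.
apply: (ext_coloring (d := fun _ _ => k) e_sym cS dS) => // x y /set1P->.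
  by move=> Sy; apply: (rainbow_fresh cS dS (set11 v) Sw).
by move=> /set1P->; apply: rainbow_refl; apply: setU11.
Qed.

(** All vertices but [w] are neighbors of [v], and [w] is reached through one of its own neighbors,
    so a single old color on all edges at [v] will do. *)
Lemma rcol_add_dominating f S v w k : symmetric f -> conn f S -> 1 < #|S| ->
  v \notin S -> w \in S -> {in S, forall x, x != w -> f v x} -> 1 < k ->
  rcol f S k -> rcol f (v |: S) k.
Proof.
move=> f_sym conS S_gt1 SNv Sw fv k_gt1 [c cS].
have dS : [disjoint S & [set v]] by rewrite disjoint_sym disjoints1.
have [x0 /setD1P[x0w Sx0] wx0] := conn_nbr conS Sw S_gt1.
(* [i] differs from the color of [x0 w], so [v x0 w] is rainbow. *)
pose i := if c x0 w == 0 then 1 else 0.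
have i_x0w : i != c x0 w.
  by rewrite /i; case: (eqVneq (c x0 w) 0) => [->|nz] //; rewrite eq_sym.
have ik : i < k by rewrite /i; case: ifP => // _; lia.
have vS x : x \in S -> x \in v |: S by move=> Sx; rewrite inE Sx orbT.
apply: (ext_coloring (d := fun _ _ => i) f_sym cS dS) => // x y /set1P->.
  have [-> _|yw Sy] := eqVneq y w; last first.
    by apply: rainbow_edge; rewrite ?setU11 ?vS ?fv.
  apply: (rainbow_via (z := x0)); rewrite ?setU11 ?vS ?fv // 1?f_sym //.
  by rewrite ext_colorl ?set11 // /ext_color (disjointFr dS Sx0) (disjointFr dS Sw).
by move=> /set1P->; apply: rainbow_refl; apply: setU11.
Qed.

(** * Putting back two vertices at once *)

Section AddPair.
Variables (e : rel T) (S : {set T}) (u v : T).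
Hypotheses (e_sym : symmetric e) (SNu : u \notin S) (SNv : v \notin S).

Let pairS x : x \in S -> (x == u = false) * (x == v = false).
Proof.
by move=> Sx; split; apply/negbTE; [apply: contraNneq SNu|apply: contraNneq SNv] => <-.
Qed.

Let disS : [disjoint S & [set u; v]].
Proof.
by rewrite disjoints_subset; apply/subsetP => x Sx; rewrite !inE !(pairS Sx).
Qed.

Let N := [set u; v].
Let Nu : u \in N. Proof. exact: set21. Qed.
Let Nv : v \in N. Proof. exact: set22. Qed.
Let NSu : u \in N :|: S. Proof. by rewrite inE Nu. Qed.
Let NSv : v \in N :|: S. Proof. by rewrite inE Nv. Qed.
Let inNS x : x \in S -> x \in N :|: S. Proof. by rewrite inE orbC => ->. Qed.

Let rainbow_pair c : (forall x y, c x y = c y x) -> rainbow e (N :|: S) c u v ->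
  forall x y, x \in N -> y \in N -> rainbow e (N :|: S) c x y.
Proof.
move=> cs ruv x y /set2P[]-> /set2P[]->; try exact: rainbow_refl; first by [].
exact: rainbow_sym.
Qed.

Lemma rcol_add_adjacent a b k : a \in S -> b \in S -> e u a -> e v b -> e u v ->
  rcol e S k -> rcol e (N :|: S) k.+1.
Proof.
move=> Sa Sb ua vb uv [c cS].
(* One fresh color serves all edges from the pair to [S], since no chosen walk uses two of them; the
   edge [u v] joins only its own ends and may have any color. *)
pose d x y := if (x \in N) && (y \in N) then 0 else k.
have ds x y : d x y = d y x by rewrite /d andbC.
have dk x y : d x y < k.+1 by rewrite /d; case: ifP.
have dS x y : y \in S -> d x y = k.
  by move=> Sy; rewrite /d (disjointFr disS Sy) andbF.
apply: (ext_coloring (d := d) e_sym cS disS) => //.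
- move=> x y /set2P[]-> Sy.
    by apply: (rainbow_fresh cS disS Nu Sa); rewrite ?dS.
  by apply: (rainbow_fresh cS disS Nv Sb); rewrite ?dS.
- apply: rainbow_pair => [x y|]; last exact: rainbow_edge.
  by case: cS => cs _ _; rewrite /ext_color orbC cs ds.
Qed.

(** From [v], the set [S] is reached by the fresh color through [w'], which frees the edge [v w] for
    linking [v] to [u]. *)
Lemma rcol_add_common w w' k : w \in S -> w' \in S -> w' != w ->
  e u w -> e v w -> e v w' -> u != v -> rcol e S k -> rcol e (N :|: S) k.+1.
Proof.
move=> Sw Sw' w'w uw vw vw' uv [c cS].
have k_gt0 : 0 < k by case: cS => _ /(_ u u); case: k.
(* The edge [v w] gets an old color, so [u w v] is rainbow. *)
pose d x y := if (x == v) && (y == w) || (x == w) && (y == v) then 0 else k.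
have ds x y : d x y = d y x by rewrite /d orbC (andbC (x == w)) (andbC (x == v)).
have dk x y : d x y < k.+1 by rewrite /d; case: ifP.
have duw : d u w = k by rewrite /d (negPf uv) (pairS Sw) andbF.
have dvw : d v w = 0 by rewrite /d !eqxx.
have dvw' : d v w' = k.
  by rewrite /d (negPf w'w) [v == w]eq_sym (pairS Sw) andbF.
apply: (ext_coloring (d := d) e_sym cS disS) => //.
- move=> x y /set2P[]-> Sy.
    by apply: (rainbow_fresh cS disS Nu Sw); rewrite ?duw.
  by apply: (rainbow_fresh cS disS Nv Sw'); rewrite ?dvw'.
- apply: rainbow_pair => [x y|].
    by case: cS => cs _ _; rewrite /ext_color orbC cs ds.
  apply: (rainbow_via (z := w)); rewrite ?NSu ?NSv ?inNS // 1?e_sym //.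
  by rewrite ext_colorl // ext_colorr // duw ds dvw -lt0n.
Qed.

Lemma rcol_add_dominating_edge k : u != v -> e u v -> {in S, forall x, e u x || e v x} ->
  2 < k -> rcol e S k -> rcol e (N :|: S) k.
Proof.
move=> uNv uv dom k_gt2 [c cS].
(* Color 0 on [u v], 1 from [u] to [S], 2 from [v] to [S]: a vertex not adjacent to one of [u], [v]
   is reached from it through the other, by colors 0 and 2 or 0 and 1. *)
pose d x y := if (x \in N) && (y \in N) then 0 else
  if (x == u) || (y == u) then 1 else 2.
have ds x y : d x y = d y x by rewrite /d andbC orbC.
have dk x y : d x y < k by rewrite /d; case: ifP => _; [lia | case: ifP => _; lia].
have c's x y : ext_color N c d x y = ext_color N c d y x.
  by case: cS => cs _ _; rewrite /ext_color orbC cs ds.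
have duv : d u v = 0 by rewrite /d Nu Nv.
have du y : y \in S -> d u y = 1.
  by move=> Sy; rewrite /d eqxx (disjointFr disS Sy) andbF.
have dv y : y \in S -> d v y = 2.
  move=> Sy; rewrite /d eq_sym (negPf uNv) (pairS Sy).
  by rewrite (disjointFr disS Sy) andbF.
apply: (ext_coloring (d := d) e_sym cS disS) => //.
- move=> x y Nx Sy; have [xy|nxy] := boolP (e x y).
    by apply: rainbow_edge => //; [rewrite inE Nx | apply: inNS].
  have := dom y Sy; move: Nx nxy => /set2P[]-> /negPf-> => [/= vy|].
    by apply: (rainbow_via (z := v)); rewrite ?NSu ?NSv ?inNS // !ext_colorl // duv dv.
  rewrite orbF => uy.
  apply: (rainbow_via (z := u)); rewrite ?NSu ?NSv ?inNS // 1?e_sym //.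
  by rewrite !ext_colorl // ds duv du.
- exact: rainbow_pair (rainbow_edge _ _ _ _).
Qed.

End AddPair.


(** The set [R] grows to [S] through attached vertices, each costing one fresh color. Started from
    an edge, this is the spanning tree bound. *)
Lemma rcol_extend e R S r k : symmetric e -> conn e S -> conn e R ->
  R \subset S -> r \in R -> rcol e R k -> rcol e S (k + (#|S| - #|R|)).
Proof.
move=> e_sym conS.
have [m] := ubnP (#|S| - #|R|); elim: m R k => // m IHm R k Rm conR sRS Rr colR.
have [<-|RS] := eqVneq R S; first by rewrite subnn addn0.
have [y [Sy RNy conyR [a Ra ay]]] := conn_grow e_sym conR conS sRS Rr RS.
have cyR : rcol e (y |: R) k.+1 by apply: (rcol_add (w := a)); rewrite // e_sym.
have syRS : y |: R \subset S by rewrite subUset sub1set Sy.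
have yR : #|y |: R| = #|R|.+1 by rewrite cardsU1 RNy.
have := subset_leq_card syRS; rewrite yR => RltS.
have -> : k + (#|S| - #|R|) = k.+1 + (#|S| - #|y |: R|) by rewrite yR; lia.
apply: IHm; rewrite ?yR ?inE ?Rr ?orbT //.
by move: Rm RltS; lia.
Qed.

Lemma rcol_pair e x y : symmetric e -> e x y -> rcol e [set x; y] 1.
Proof.
move=> e_sym xy; apply: rcol_clique => a b /set2P[]-> /set2P[]->; rewrite ?eqxx //.
by rewrite e_sym.
Qed.

Lemma conn2 e x y : symmetric e -> e x y -> conn e [set x; y].
Proof.
move=> e_sym xy; rewrite setUC -/(y |: [set x]).
by apply: (conn_add (x := x)); rewrite ?set11 //; apply: conn1.
Qed.

Lemma rcol_card e S : symmetric e -> conn e S -> 1 < #|S| ->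
  rcol e S #|S|.-1.
Proof.
move=> e_sym conS S_gt1.
have /card_gt0P[x Sx] : 0 < #|S| by lia.
have [y /setD1P[yx Sy] xy] := conn_nbr conS Sx S_gt1.
have := rcol_extend (r := x) e_sym conS (conn2 e_sym xy) _ _ (rcol_pair e_sym xy).
rewrite cards2 eq_sym yx set21 subUset !sub1set Sx Sy => /(_ isT isT).
by congr rcol; lia.
Qed.

End RainbowSets.

(** * The upper bound on induced subgraphs *)

Section NordhausGaddum.
Variable T : finType.
Implicit Types (e f : rel T) (S N R X : {set T}) (u v w x y z : T).
Implicit Types (k l : nat).

(** The induction invariant. The numbers [k] and [l] need not be minimal; keeping both at least 2
    lets [rcol_add_dominating] apply when a leaf is put back. *)
Definition rcol_sum e f S := exists k l,
  [/\ rcol e S k, rcol f S l, 1 < k, 1 < l & k + l <= #|S| + 2].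

Lemma rcol_sumC e f S : rcol_sum e f S -> rcol_sum f e S.
Proof. by move=> [k [l [? ? ? ? ?]]]; exists l, k; split; rewrite // addnC. Qed.

Lemma leaf_or_two_nbrs e S v : conn e S -> v \in S -> 1 < #|S| ->
  (exists w, [/\ w \in S :\ v, e v w & {in S :\ v, forall x, x != w -> ~~ e v x}]) \/
  (exists w w', [/\ w \in S :\ v, w' \in S :\ v, w' != w, e v w & e v w']).
Proof.
move=> conS Sv S_gt1; have [w Sw vw] := conn_nbr conS Sv S_gt1.
have [[w' [Sw' w'w vw']]|no] := EM (exists w', [/\ w' \in S :\ v, w' != w & e v w']).
  by right; exists w, w'.
left; exists w; split=> // x Sx xw; apply/negP => vx.
by apply: no; exists x.
Qed.

Lemma rcol_sum_leaf e f S v w : symmetric e -> symmetric f -> co e f ->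
  v \in S -> 2 < #|S| -> conn f (S :\ v) -> w \in S :\ v -> e v w ->
  {in S :\ v, forall x, x != w -> ~~ e v x} ->
  rcol_sum e f (S :\ v) -> rcol_sum e f S.
Proof.
move=> e_sym f_sym ef Sv S_gt2 conf Sw vw leaf [k [l [ek fl k_gt1 l_gt1 kl]]].
have S1 : #|S| = #|S :\ v|.+1 by rewrite (cardsD1 v S) Sv.
have ek' : rcol e S k.+1.
  by rewrite -(setD1K Sv); apply: (rcol_add (w := w)); rewrite ?setD11.
have fl' : rcol f S l.
  rewrite -(setD1K Sv); apply: (rcol_add_dominating (w := w)); rewrite ?setD11 //.
    by rewrite -ltnS -S1.
  by move=> x Sx xw; rewrite ef ?leaf // eq_sym; case/setD1P: Sx.
by exists k.+1, l; split=> //; [exact: ltnW | rewrite S1 !addSn ltnS].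
Qed.

Lemma rcol_sum_pair e f S u v a a' b b' :
  symmetric e -> symmetric f -> co e f -> conn e S ->
  v \in S -> u \in S :\ v -> 4 < #|S| -> conn e (S :\ v) -> conn f (S :\ v) ->
  a \in S :\ v -> a' \in S :\ v -> a' != a -> e v a -> e v a' ->
  b \in S :\ v -> b' \in S :\ v -> b' != b -> f v b -> f v b' ->
  f u v -> rcol_sum e f (S :\ v :\ u) -> rcol_sum e f S.
Proof.
move=> e_sym f_sym ef conS Sv Su S_gt4 conSv fonSv Sa Sa' a'a va va' Sb Sb' b'b vb vb' uv.
move=> [k [l [ek fl k_gt1 l_gt1 kl]]].
set H := S :\ v :\ u in ek fl kl.
have S1 : #|S| = #|S :\ v|.+1 by rewrite (cardsD1 v S) Sv.
have S2 : #|S :\ v| = #|H|.+1 by rewrite (cardsD1 u) Su.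
have vu : u != v by case/setD1P: Su.
have HNu : u \notin H by rewrite setD11.
have HNv : v \notin H by rewrite !inE eqxx andbF.
have SH : S = [set u; v] :|: H.
  by rewrite -setUA [v |: H]setUC -/H -(setD1K Sv) -[in LHS](setD1K Su) setUCA [H :|: _]setUC.
have euv : ~~ e u v by rewrite -ef.
have Sv_gt1 : 1 < #|S :\ v| by rewrite -ltnS -S1; do 2!apply: ltnW.
have [w0 Hw0 uw0] := conn_nbr conSv Su Sv_gt1.
have [y0 Hy0 uy0] := conn_nbr fonSv Su Sv_gt1.
have HE x : x \in S :\ v -> x != u -> x \in H by move=> Sx xu; rewrite inE Sx inE xu.
have e_nbr x : x \in S :\ v -> e v x -> x \in H.
  by move=> Sx vx; apply: HE => //; apply: contraNneq euv => <-; rewrite e_sym.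
have [y1 Hy1 vy1] : exists2 y1, y1 \in H & f v y1.
  have [bu|bu] := eqVneq b u; last by exists b => //; apply: HE.
  by exists b' => //; apply: HE; rewrite // -bu.
(* A common [e]-neighbor [w]: each graph pays one color for two vertices. The second [e]-neighbor of
   [v] lies in [H] because [u] is not adjacent to [v] in [e]. *)
have [[w [Hw uw vw]]|no] := EM (exists w, [/\ w \in H, e u w & e v w]).
  have [w' [Hw' w'w vw']] : exists w', [/\ w' \in H, w' != w & e v w'].
    have [aw|aw] := eqVneq a w; last by exists a; split=> //; apply: e_nbr.
    by exists a'; split; rewrite -?aw //; apply: e_nbr.
  exists k.+1, l.+1; split; try exact: ltnW; rewrite ?SH.
  - by apply: (rcol_add_common e_sym HNu HNv Hw Hw').
  - by apply: (rcol_add_adjacent f_sym HNu HNv Hy0 Hy1).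
  - by rewrite -SH S1 S2 !addSn addnS !ltnS.
have dom : {in H, forall x, f u x || f v x}.
  move=> x Hx; have [xu xv] : u != x /\ v != x.
    by move: Hx; rewrite !inE ![x == _]eq_sym => /and3P[].
  rewrite !ef // -negb_and; apply/negP => /andP[ux vx].
  by apply: no; exists x.
have fl' m : 2 < m -> l <= m -> rcol f S m.
  move=> m2 lm; rewrite SH; apply: rcol_add_dominating_edge => //.
  exact: rcol_mono fl.
(* With [2 < l] the dominating edge is free in [f] and [e] pays for both vertices. Otherwise 3
   colors suffice in [f], and the spanning tree bound in [e] gives the total [#|S|.-1 + 3]. *)
have [l_gt2|l_le2] := ltnP 2 l.
  exists k.+2, l; split=> //; [|exact: fl'|by rewrite S1 S2 !addSn !ltnS].
  rewrite -(setD1K Sv); apply: (rcol_add (w := a)); rewrite ?setD11 //.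
  by rewrite -(setD1K Su); apply: (rcol_add (w := w0)); rewrite ?setD11.
exists #|S|.-1, 3; split=> //; last by move: S_gt4; clear; case: #|S| => // m; lia.
- by apply: rcol_card => //; do 3!apply: ltnW.
- by apply: fl' => //; apply: leq_trans l_le2 _.
- by move: S_gt4; clear; lia.
Qed.

Lemma rcol3_ear e v a b c d : symmetric e -> uniq [:: v; a; b; c; d] ->
  e v a -> e v b -> e c d -> e c a || e c b -> e d a || e d b ->
  rcol e [set v; a; b; c; d] 3.
Proof.
move=> e_sym; rewrite /= !inE !negb_or -!andbA.
move=> /and5P[va vb vc vd /and5P[ab ac ad bc /andP[bd _]]] eva evb ecd cab dab.
(* The path [a v b] takes two colors; the edge [c d], attached to it at both ends, takes one
   more. *)
have vab : rcol e [set v; a; b] 2.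
  rewrite setUC; apply: (rcol_add (w := v)) (rcol_pair _ _); rewrite ?set21 // 1?e_sym //.
  by rewrite !inE ![b == _]eq_sym negb_or vb.
have -> : [set v; a; b; c; d] = [set c; d] :|: [set v; a; b] by rewrite -setUA setUC.
have nbr x : e x a || e x b -> exists2 y, y \in [set v; a; b] & e x y.
  by case/orP=> ?; [exists a | exists b]; rewrite // !inE eqxx ?orbT.
have [c' Vc' cc'] := nbr c cab; have [d' Vd' dd'] := nbr d dab.
apply: (rcol_add_adjacent e_sym _ _ Vc' Vd') => //.
  by rewrite !inE !negb_or ![c == _]eq_sym vc ac bc.
by rewrite !inE !negb_or ![d == _]eq_sym vd ad bd.
Qed.

(** A triangle takes one color, and each of the two other vertices one more. *)
Lemma rcol3_triangle e S v a b : symmetric e -> conn e S -> #|S| = 5 ->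
  v \in S -> a \in S -> b \in S -> v != a -> v != b -> a != b ->
  e v a -> e v b -> e a b -> rcol e S 3.
Proof.
move=> e_sym eS S5 Sv Sa Sb va vb ab eva evb eab.
have tri : {in b |: [set v; a] &, forall x y, x != y -> e x y}.
  move=> x y; rewrite !inE => /or3P[]/eqP-> /or3P[]/eqP->; rewrite ?eqxx // => _;
    by rewrite // e_sym.
have conR : conn e (b |: [set v; a]).
  by apply: (conn_add (x := v) e_sym (conn2 e_sym eva)); rewrite ?set21.
have cardR : #|b |: [set v; a]| = 3.
  by rewrite cardsU1 cards2 va !inE ![b == _]eq_sym negb_or vb ab.
have := rcol_extend (r := b) e_sym eS conR _ (setU11 _ _) (rcol_clique tri).
rewrite cardR S5; apply.
by apply/subsetP => x; rewrite !inE => /or3P[]/eqP->.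
Qed.

(** A spanning tree gives 4 colors in either graph, so 3 colors in one of them are enough. The
    vertex [v] has neighbors [a], [b] in [e] and [c], [d] in [f]; a triangle or an ear at [v] is
    found in [e] or in [f]. *)
Lemma rcol_sum_five e f S v a b c d : symmetric e -> symmetric f -> co e f ->
  conn e S -> conn f S -> v \in S -> #|S| = 5 ->
  a \in S :\ v -> b \in S :\ v -> b != a -> e v a -> e v b ->
  c \in S :\ v -> d \in S :\ v -> d != c -> f v c -> f v d ->
  rcol_sum e f S.
Proof.
move=> e_sym f_sym ef eS fS Sv S5 /setD1P[av Sa] /setD1P[bv Sb] ba eva evb.
move=> /setD1P[cv Sc] /setD1P[dv Sd] dc fvc fvd.
have rcol4 g : symmetric g -> conn g S -> rcol g S 4.
  by move=> g_sym gS; rewrite -[4]/(5.-1) -S5; apply: rcol_card => //; rewrite S5.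
have e3 : rcol e S 3 -> rcol_sum e f S by exists 3, 4; split; rewrite ?S5 //; exact: rcol4.
have f3 : rcol f S 3 -> rcol_sum e f S by exists 4, 3; split; rewrite ?S5 //; exact: rcol4.
have efN x y : e v x -> f v y -> x != v -> x != y.
  by move=> vx vy xv; apply: contraTneq vy => <-; rewrite ef ?vx // eq_sym.
have [ac ad bc bd] : [/\ a != c, a != d, b != c & b != d] by split; exact: efN.
have Uv : uniq [:: v; a; b; c; d].
  rewrite /= !inE !negb_or ![v == _]eq_sym av bv cv dv [a == b]eq_sym ba.
  by rewrite ac ad bc bd [c == d]eq_sym dc.
have SE : S = [set v; a; b; c; d].
  have sub : {subset [:: v; a; b; c; d] <= enum S}.
    by move=> x; rewrite mem_enum !inE => /or4P[|||/orP[]] /eqP->.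
  have [|_ SE] := uniq_min_size Uv sub; first by rewrite -cardE S5.
  by apply/setP => x; rewrite -mem_enum -SE !inE !orbA.
have SE' : S = [set v; c; d; a; b].
  by rewrite SE; apply/setP => x; rewrite !inE; do 5!case: (x == _).
have Uv' : uniq [:: v; c; d; a; b].
  rewrite -(perm_uniq (s1 := [:: v; a; b; c; d])) // perm_cons.
  by rewrite (perm_catC [:: a; b] [:: c; d]).
have [eab|neab] := boolP (e a b).
  by apply/e3/(@rcol3_triangle e S v a b); rewrite // eq_sym.
have [fcd|nfcd] := boolP (f c d).
  by apply/f3/(@rcol3_triangle f S v c d); rewrite // eq_sym.
have fab : f a b by rewrite ef // eq_sym.
have ecd : e c d by rewrite (coC ef) // eq_sym.
(* Without triangles, [a b] is an edge of [f] and [c d] one of [e]. If [c] or [d] sees neither [a]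
   nor [b] in [e], it sees both in [f], and [a b] is an ear on the path [c v d] of [f]; otherwise
   [c d] is an ear on [a v b] in [e]. *)
have ear_f : f c a && f c b || f d a && f d b -> rcol_sum e f S.
  move=> cd_ab; apply: f3; rewrite SE'; apply: rcol3_ear; rewrite // !(f_sym _ c) !(f_sym _ d).
    by case/orP: cd_ab => /andP[-> _]; rewrite ?orbT.
  by case/orP: cd_ab => /andP[_ ->]; rewrite ?orbT.
have ncab x : x != a -> x != b -> ~~ (e x a || e x b) -> f x a && f x b.
  by move=> xa xb; rewrite negb_or !ef.
have [cab|/ncab cab] := boolP (e c a || e c b); last first.
  by apply: ear_f; rewrite cab // eq_sym.
have [dab|/ncab dab] := boolP (e d a || e d b); last first.
  by apply: ear_f; rewrite dab ?orbT // eq_sym.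
by apply: e3; rewrite SE; apply: rcol3_ear.
Qed.

Theorem rcol_sum_bound e f S : symmetric e -> symmetric f -> co e f ->
  conn e S -> conn f S -> 3 < #|S| -> rcol_sum e f S.
Proof.
move=> e_sym f_sym ef.
have [n] := ubnP #|S|; elim: n S => // n IHn S Sn eS fS S_gt3.
have [S_gt4|S_le4] := ltnP 4 #|S|; last first.
  have S4 : #|S| = 4 by apply/eqP; rewrite eqn_leq S_le4.
  (* On four vertices two spanning trees already give 3 + 3 = 4 + 2. *)
  by exists 3, 3; rewrite S4; split; rewrite // -[3]/(4.-1) -S4;
    apply: rcol_card => //; rewrite S4.
have [v [Sv eSv fSv]] := common_noncut e_sym f_sym ef eS fS S_gt4.
have S1 : #|S| = #|S :\ v|.+1 by rewrite (cardsD1 v S) Sv.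
have S_gt1 : 1 < #|S| by do 3!apply: ltnW.
have IH1 : rcol_sum e f (S :\ v) by apply: IHn; rewrite // -ltnS -S1 //; exact: ltnW.
have [[w [Sw vw leaf]]|[a [a' [Sa Sa' a'a va va']]]] :=
  leaf_or_two_nbrs eS Sv S_gt1.
  by apply: (rcol_sum_leaf e_sym f_sym ef Sv _ fSv Sw vw leaf) => //; do 2!apply: ltnW.
have [[w [Sw vw leaf]]|[b [b' [Sb Sb' b'b vb vb']]]] :=
  leaf_or_two_nbrs fS Sv S_gt1.
  apply/rcol_sumC/(rcol_sum_leaf f_sym e_sym (coC ef) Sv _ eSv Sw vw leaf).
    by do 2!apply: ltnW.
  exact: rcol_sumC.
(* Removing two of five vertices would leave three, too few for the induction hypothesis. *)
have [S_gt5|S_le5] := ltnP 5 #|S|; last first.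
  by apply: (@rcol_sum_five e f S v a a' b b') => //; apply/eqP; rewrite eqn_leq S_le5.
have [|u [Su eSu fSu]] := common_noncut e_sym f_sym ef eSv fSv; first by rewrite -ltnS -S1.
have S2 : #|S :\ v| = #|S :\ v :\ u|.+1 by rewrite (cardsD1 u) Su.
have IH2 : rcol_sum e f (S :\ v :\ u)
  by apply: IHn => //; [move: Sn | move: S_gt5]; rewrite S1 S2 // => /ltnW.
have uv : u != v by case/setD1P: Su.
have [fuv|nfuv] := boolP (f u v).
  exact: (@rcol_sum_pair e f S u v a a' b b').
apply/rcol_sumC/(@rcol_sum_pair f e S u v b b' a a') => //; last exact: rcol_sumC.
- exact: coC.
- by rewrite (coC ef).
Qed.
End NordhausGaddum.

(** * Rainbow colorings of simple graphs *)

Section Graphs.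
Variable G : sgraph.
Implicit Types (x y u v : G) (p : seq G).

Lemma connected_conn : connected G -> conn (@adj G) setT.
Proof.
move=> conG X [x _ Xx] clX y _.
have clXa : closed (@adj G) X.
  by move=> a b ab; apply/idP/idP => /clX; apply; rewrite // adj_sym.
by rewrite -(closed_connect clXa (conG x y)).
Qed.

Lemma connected_from (r : G) : (forall x, connect (@adj G) r x) -> connected G.
Proof.
move=> conr x y; apply: connect_trans (conr y).
by rewrite (sym_connect_sym (@adj_sym G)).
Qed.

(** When the first vertex occurs again, the loop is cut off. The colors that remain form a
    subsequence of the old ones, so distinctness survives. *)
Lemma walk_path S (c : G -> G -> nat) x y s : walk (@adj G) S c x y s ->
  exists p, [/\ path (@adj G) x p, last x p = y, uniq (x :: p)
    & subseq (pairmap c x p) s].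
Proof.
elim=> {x y s} [x _|x y z s _ xy _ [p [yp lp Up sp]]].
  by exists [::].
have [xp|xNp] := boolP (x \in y :: p); last first.
  by exists (y :: p); rewrite /= xy yp eqxx; split=> //; rewrite xNp.
move: yp lp Up sp; case/splitPl: p / xp => p1 p2 p1x.
rewrite cat_path last_cat p1x -cat_cons cat_uniq => /andP[_ xp2] lp2 /and3P[_ xNp2 Up2].
rewrite pairmap_cat p1x => sp; exists p2; split=> //.
  rewrite /= Up2 andbT; apply/negP => xp2'; case/negP: xNp2.
  by apply/hasP; exists x => //=; rewrite -p1x mem_last.
apply: subseq_trans (subseq_cons _ _); apply: subseq_trans sp; exact: suffix_subseq.
Qed.

Lemma set2_eq (a b x y : G) : [set a; b] = [set x; y] ->
  a = x /\ b = y \/ a = y /\ b = x.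
Proof.
move=> abxy; have: a \in [set x; y] by rewrite -abxy set21.
have: b \in [set x; y] by rewrite -abxy set22.
have: x \in [set a; b] by rewrite abxy set21.
have: y \in [set a; b] by rewrite abxy set22.
rewrite !inE => /orP[]/eqP yE /orP[]/eqP xE /orP[]/eqP bE /orP[]/eqP aE;
  subst; by [left | right].
Qed.

(** Turns a symmetric function on pairs into a coloring of edges as sets. The successor moves colors
    from below [k] to the range from 1 to [k]; the default 1 is for sets not of the form
    [[set x; y]]. *)
Definition set_color (c : G -> G -> nat) (A : {set G}) : nat :=
  if [pick p : G * G | A == [set p.1; p.2]] is Some p then (c p.1 p.2).+1 else 1.

Lemma set_color2 c x y : (forall x y, c x y = c y x) ->
  set_color c [set x; y] = (c x y).+1.
Proof.
move=> cs; rewrite /set_color; case: pickP => [[a b] /= /eqP/set2_eq ab|].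
  by case: ab => -[-> ->]; rewrite // cs.
by move=> /(_ (x, y)) /=; rewrite eqxx.
Qed.

Lemma rcol_colorable k : rcol (@adj G) setT k -> rainbow_colorable G k.
Proof.
move=> [c [cs ck rb]]; exists (set_color c).
  by move=> A /imset2P[x y _ _ ->]; rewrite set_color2 ?ck.
move=> u v; have [s w Us] := rb u v (in_setT u) (in_setT v).
have [p [up lp Up sp]] := walk_path w; exists p; split=> //.
have -> : [seq set_color c A | A <- path_edges u p] = map succn (pairmap c u p).
  elim: p u {up lp Up sp w} => //= y p IHp u.
  by rewrite set_color2 // -/(path_edges y p) IHp.
by rewrite map_inj_uniq; [apply: subseq_uniq sp Us | apply: succn_inj].
Qed.

Lemma path_edges_edges u p : path (@adj G) u p -> {subset path_edges u p <= edges G}.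
Proof.
elim: p u => //= y p IHp u /andP[uy yp] A; rewrite inE => /orP[/eqP->|]; last exact: IHp.
by apply: imset2_f; rewrite inE.
Qed.

Lemma rainbow_path_size k c u v p :
  edge_coloring k c -> rainbow_path c u v p -> size p <= k.
Proof.
move=> ck [up _ _ Uc]; have szp : size [seq c A | A <- path_edges u p] = size p.
  by rewrite size_map size_pairmap.
rewrite -szp -(size_iota 1 k); apply: uniq_leq_size => // _ /mapP[A Ap ->].
by rewrite mem_iota add1n ltnS; apply: ck; apply: path_edges_edges Ap.
Qed.

(** A path whose ends lie on different sides of [X] crosses the cut somewhere, and [E] is the only
    edge there. *)
Lemma cut_edge_in_path (X E : {set G}) u p :
  (forall x y, adj x y -> (x \in X) != (y \in X) -> [set x; y] = E) ->
  path (@adj G) u p -> (u \in X) != (last u p \in X) -> E \in path_edges u p.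
Proof.
move=> cutE; elim: p u => [|y p IHp] u /=; first by rewrite eqxx.
move=> /andP[uy yp] uXl; rewrite inE.
have [/eqP uXy|uXy] := boolP ((u \in X) == (y \in X)); last by rewrite (cutE u y) ?eqxx.
by rewrite -/(path_edges y p) IHp ?orbT // -uXy.
Qed.

Lemma rainbow_path_inj c u v p (A B : {set G}) : rainbow_path c u v p ->
  A \in path_edges u p -> B \in path_edges u p -> c A = c B -> A = B.
Proof.
case=> _ _ _ Uc Ap Bp cAB.
rewrite -(nth_index set0 Ap) -(nth_index set0 Bp); congr nth.
apply/eqP; rewrite -(nth_uniq 0 _ _ Uc) ?size_map ?index_mem //.
by rewrite !(nth_map set0) ?index_mem // !nth_index // cAB.
Qed.

End Graphs.

Lemma rc_sum_le (G : sgraph) (conG : connected G) (conGc : connected (compl G)) :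
  4 <= #|G| -> rc conG + rc conGc <= #|G| + 2.
Proof.
move=> G4.
have ef : co (@adj G) (@adj (compl G)) by move=> x y xy; rewrite -[RHS]andTb -xy.
have [] := rcol_sum_bound (@adj_sym G) (@adj_sym (compl G)) ef
  (connected_conn conG) (connected_conn conGc); first by rewrite cardsT.
move=> k [l [ek fl _ _]]; rewrite cardsT; apply: leq_trans; apply: leq_add.
  by have [_] := rcP conG; apply; apply: rcol_colorable.
by have [_] := rcP conGc; apply; apply: rcol_colorable.
Qed.

(** * The extremal graph *)

Section Spider.
Variable m : nat.

Definition spider_adj (x y : 'I_m.+4) : bool :=
  [|| (x == 0 :> nat) && (0 < y < m.+3), (y == 0 :> nat) && (0 < x < m.+3),
      (x == 1 :> nat) && (y == m.+3 :> nat)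
    | (y == 1 :> nat) && (x == m.+3 :> nat)].

Lemma spider_sym : symmetric spider_adj.
Proof. by move=> x y; rewrite /spider_adj /=; lia. Qed.

Lemma spider_irrefl : irreflexive spider_adj.
Proof. by move=> x; rewrite /spider_adj /=; lia. Qed.

(* A star with center [0] and leaves [1 .. m+2], with [m+3] hanging from [1]. *)
Definition spider := SGraph spider_sym spider_irrefl.

Let v1 : spider := inord 1.
Let v2 : spider := inord 2.
Let val1 : v1 = 1 :> nat. Proof. exact: inordK. Qed.
Let val2 : v2 = 2 :> nat. Proof. exact: inordK. Qed.

Lemma spider_connected : connected spider.
Proof.
apply: (connected_from (r := ord0 : spider)) => x.
have [x0|x0] := eqVneq (x : nat) 0.
  by rewrite (_ : x = ord0) ?connect0 //; apply: val_inj.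
have [xm|xm] := eqVneq (x : nat) m.+3; last first.
  by apply: connect1; rewrite /= /spider_adj /=; have := ltn_ord x; lia.
apply: (connect_trans (y := v1)); apply: connect1; rewrite /= /spider_adj /= val1 //.
by rewrite xm !eqxx orbT.
Qed.

Lemma spider_compl_connected : connected (compl spider).
Proof.
have adjE (x y : compl spider) : adj x y = (x != y :> nat) && ~~ spider_adj x y by [].
apply: (connected_from (r := ord_max : compl spider)) => x.
have [x0|x0] := eqVneq (x : nat) m.+3.
  by rewrite (_ : x = ord_max) ?connect0 //; apply: val_inj.
have [x1|x1] := eqVneq (x : nat) 1; last first.
  by apply: connect1; rewrite adjE /= /spider_adj /=; have := ltn_ord x; lia.
apply: (connect_trans (y := (v2 : compl spider))); apply: connect1;
  rewrite adjE /= /spider_adj /= val2; lia.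
Qed.

(** * Lower bounds for the spider and its complement *)

Definition parent (x : spider) : spider := if x == m.+3 :> nat then v1 else ord0.

(** For [x] other than the root 0, the subtree hanging at [x]; the edge from [x] to its parent is
    the only one that leaves it. *)
Definition branch (x : spider) : {set spider} :=
  [set y | (y == x) || (x == 1 :> nat) && (y == m.+3 :> nat)].

Lemma branch_cut (i x y : spider) : i != ord0 -> adj x y ->
  (x \in branch i) != (y \in branch i) -> [set x; y] = [set parent i; i].
Proof.
move=> i0 xy; rewrite !inE => xiy.
suff [[xi yi]|[xi yi]] : x = i /\ y = parent i \/ y = i /\ x = parent i.
- by rewrite setUC xi yi.
- by rewrite xi yi.
have pE : parent i = (if i == m.+3 :> nat then 1 else 0) :> nat.
  by rewrite /parent; case: ifP.
suff : x = i :> nat /\ y = parent i :> nat \/ y = i :> nat /\ x = parent i :> nat.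
  by case=> -[/val_inj-> /val_inj->]; [left|right].
rewrite pE; move: i0 xy xiy; rewrite -!val_eqE /= /spider_adj /=.
by have := ltn_ord x; have := ltn_ord y; have := ltn_ord i; case: ifP; lia.
Qed.

(** Any two edges separate a common pair of vertices, so both lie on the rainbow path between these
    and differ in color. Edges are indexed by their lower ends, the [m.+3] vertices other than the
    root. *)
Lemma spider_colors k : rainbow_colorable spider k -> m.+3 <= k.
Proof.
move=> [c ck rb]; pose E i := [set parent i; i].
(* The leaf at the end of the branch of [i]. Edges on different legs are separated by these leaves,
   the two edges of the long leg by its leaf and the center. *)
pose rep (i : spider) : spider := if i == 1 :> nat then ord_max else i.
have sep i j : i != ord0 -> j != ord0 -> i != j -> exists u v : spider,
    (u \in branch i) != (v \in branch i) /\ (u \in branch j) != (v \in branch j).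
  move=> i0 j0 ij.
  have [sp|nsp] := boolP ((i == 1 :> nat) && (j == m.+3 :> nat)
    || (j == 1 :> nat) && (i == m.+3 :> nat)).
    exists ord_max, ord0; move: i0 j0 ij sp; rewrite !inE -!val_eqE /=; lia.
  exists (rep i), (rep j); move: i0 j0 ij nsp; rewrite !inE -!val_eqE /rep /=.
  have := ltn_ord i; have := ltn_ord j.
  by do 2!case: ifP => /=; lia.
have E_edge i : i != ord0 -> E i \in edges spider.
  rewrite -val_eqE /= => i0; apply: imset2_f; rewrite ?inE //=.
  rewrite /parent /spider_adj /=; have := ltn_ord i; case: ifP => /=; rewrite ?val1; lia.
have E_inj : {in predC1 ord0 &, injective (c \o E)}.
  move=> i j; rewrite !inE => i0 j0 /= cE; apply/eqP/negPn/negP => ij.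
  have [u [v [iuv juv]]] := sep i j i0 j0 ij.
  have [p rp] := rb u v; have [up lp _ _] := rp.
  have Ep l : l != ord0 -> (u \in branch l) != (v \in branch l) -> E l \in path_edges u p.
    move=> l0 luv; apply: (cut_edge_in_path (X := branch l)) up _; last by rewrite lp.
    by move=> x y; apply: branch_cut.
  have /set2_eq := rainbow_path_inj rp (Ep i i0 iuv) (Ep j j0 juv) cE.
  move: ij i0 j0; rewrite -!val_eqE /= => ij i0 j0 [] [/(congr1 val) + /(congr1 val)];
    rewrite /parent; do 2!case: ifP; rewrite /= ?val1; lia.
rewrite -(size_iota 1 k) (_ : m.+3 = size [seq c (E i) | i in predC1 ord0]); last first.
  by rewrite size_map -cardE cardC1 card_ord.
apply: uniq_leq_size.
  rewrite map_inj_in_uniq ?enum_uniq // => i j.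
  by rewrite !mem_enum; apply: E_inj.
move=> _ /imageP[i i0 ->]; rewrite mem_iota add1n ltnS.
by apply: ck; apply: E_edge.
Qed.

(** In the complement the only neighbor of 0 is [m.+3], which is not adjacent to 1 there; so 0 and 1
    are at distance at least 3. *)
Lemma spider_compl_colors k : rainbow_colorable (compl spider) k -> 3 <= k.
Proof.
move=> [c ck rb]; have [p rp] := rb (ord0 : compl spider) (v1 : compl spider).
apply: leq_trans (rainbow_path_size ck rp); case: rp => + + _ _.
case: p => [|a [|b [|d p]]] //= + /(congr1 val) /=;
  rewrite /compl_adj /= -?val_eqE /= /spider_adj /= ?val1 //; first by lia.
have := ltn_ord a; have := ltn_ord b; lia.
Qed.
End Spider.

Theorem theorem1 (n : nat) (hn : 4 <= n) :
  (forall (G : sgraph) (conG : connected G) (conGc : connected (compl G)),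
     #|G| = n -> rc conG + rc conGc <= n + 2) /\
  (exists (G : sgraph) (conG : connected G) (conGc : connected (compl G)),
     #|G| = n /\ rc conG + rc conGc = n + 2).
Proof.
split=> [G conG conGc Gn|]; first by rewrite -Gn; apply: rc_sum_le; rewrite Gn.
case: n hn => [|[|[|[|m]]]] // _.
exists (spider m), (@spider_connected m), (@spider_compl_connected m).
have cardG : #|spider m| = m.+4 by rewrite card_ord.
split=> //; apply/eqP; rewrite eqn_leq -{1}cardG rc_sum_le ?cardG //=.
have [/spider_colors le_rc _] := rcP (@spider_connected m).
have [/spider_compl_colors le_rcc _] := rcP (@spider_compl_connected m).
(* The sum [m.+4 + 2] is split as [m.+3 + 3], the lower bounds for the tree and for its
   complement. *)
by rewrite -[m.+4]addn1 -addnA leq_add.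
Qed.
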